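(* There exists a constant $\gamma>0$ such that for every constant $0<\eta\le 0.1$, for every connected $P_6$-free graph $G$ on at least two vertices, for every threshold $\tau$ with $(1-2\eta)|V(G)|\le\tau\le(1-\eta)|V(G)|$, for every inclusion-wise minimal $(\eta,\tau)$-nuke $X$ in $G$, and for every probability measure $\mu$ on $X$, there exists a vertex $v\in V(G)$ with $\mu(N(v))\ge\gamma$.
   Context: All graphs are finite, simple and undirected. $P_k$ denotes the path on $k$ vertices; $G$ is $P_k$-free if it has no induced subgraph isomorphic to $P_k$. $N(v)$ is the open neighbourhood of $v$, and $\mu(N(v))$ means $\mu(N(v)\cap X)$. For a constant $0<\eta\le 0.1$ and a threshold $\tau\ge 0$, a set $X\subseteq V(G)$ is an $(\eta,\tau)$-nuke in $G$ if (i) $(1-2\eta)|V(G)|\le\tau\le(1-\eta)|V(G)|$, (ii) $|X|\le\eta|V(G)|$, and (iii) for every connected component $C$ of $G-X$ we have $|C|+|X|\le\tau$. An inclusion-wise minimal $(\eta,\tau)$-nuke is one no proper subset of which is an $(\eta,\tau)$-nuke in $G$. *)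

(* Defs.v *)
From Stdlib Require Import Reals.
From HB Require Import structures.
From mathcomp Require Import all_boot all_order all_algebra.
From mathcomp Require Import Rstruct.
Set Implicit Arguments. Unset Strict Implicit. Unset Printing Implicit Defensive.
Import Order.TTheory GRing.Theory Num.Theory.
Local Open Scope ring_scope.

Definition simple_graph (T : finType) (e : rel T) : Prop :=
  symmetric e /\ irreflexive e.

Definition connected_graph (T : finType) (e : rel T) : Prop :=
  forall x y : T, connect e x y.

Definition induced_P6 (T : finType) (e : rel T) (f : 'I_6 -> T) : Prop :=
  injective f /\
  forall i j : 'I_6, e (f i) (f j) = ((i.+1 == j :> nat) || (j.+1 == i :> nat)).

Definition P6_free (T : finType) (e : rel T) : Prop :=
  forall f : 'I_6 -> T, ~ induced_P6 e f.

Definition del_rel (T : finType) (e : rel T) (X : {set T}) : rel T :=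
  fun x y => [&& e x y, x \notin X & y \notin X].

(* connected component of G - X containing x (for x \notin X) *)
Definition comp_del (T : finType) (e : rel T) (X : {set T}) (x : T) : {set T} :=
  [set y | connect (del_rel e X) x y].

Definition nuke (T : finType) (e : rel T) (eta tau : R) (X : {set T}) : Prop :=
  [/\ (1 - 2 * eta) * (#|T|%:R) <= tau <= (1 - eta) * (#|T|%:R),
      (#|X|%:R : R) <= eta * (#|T|%:R) &
      forall x, x \notin X -> ((#|comp_del e X x| + #|X|)%:R : R) <= tau].

Definition minimal_nuke (T : finType) (e : rel T) (eta tau : R) (X : {set T}) : Prop :=
  nuke e eta tau X /\ forall Y : {set T}, Y \proper X -> ~ nuke e eta tau Y.

Definition prob_on (T : finType) (X : {set T}) (mu : T -> R) : Prop :=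
  [/\ forall x, 0 <= mu x, forall x, x \notin X -> mu x = 0 &
      \sum_(x in X) mu x = 1].

(* mu(N(v)) = mu(N(v) ∩ X) *)
Definition mu_nbhd (T : finType) (e : rel T) (X : {set T}) (mu : T -> R) (v : T) : R :=
  \sum_(u in X | e v u) mu u.

(* Main.v *)
Require Import Defs.
From Stdlib Require Import Reals.
From HB Require Import structures.
From mathcomp Require Import all_boot all_order all_algebra.
From mathcomp Require Import Rstruct lra.
Set Implicit Arguments. Unset Strict Implicit. Unset Printing Implicit Defensive.
Import Order.TTheory GRing.Theory Num.Theory.
Local Open Scope ring_scope.

(** By minimality every x in X touches components of G - X of total size more
than tau - |X|. As each single component has size at most tau - |X|, every x
has a neighbour outside X and outside any prescribed component; and by
averaging over the vertices of G - X some component A is touched by a set of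
measure at least 1/2. If all neighbourhoods had measure below 1/200, then
we could pick x1, x2, x3 touching A, with neighbours bi outside A and induced
paths x1..x2 and x2..x3 through A (at most three inner vertices each), such
that xi is adjacent to no bj or xj with j <> i, x3 to no inner vertex of the
first path, and x1 to none of the second. If two of the bi are adjacent, then xi bi bj xj continues
along one of the paths. If an inner path has two or more vertices, it extends by
bi and bj at its ends. Otherwise the inner vertices are single, c and d, and
either b1 x1 c d x3 b3 or b1 x1 c x2 d x3 is an induced P_6. *)

(** * Averaging over weighted triples *)

(** With [M] the total mass, each bad event has weight at most [eps * M ^+ 2] among triples weighted
    by [m x * m y * m z], so the three together cannot cover the total weight [M ^+ 3]. *)
Lemma exists_triple_avoiding (K : realFieldType) (T : finType) (m : T -> K)
    (eps : K) (B1 B2 B3 : T -> T -> pred T) :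
  (forall x, 0 <= m x) -> 3 * eps < \sum_x m x -> 0 <= eps ->
  (forall y z, \sum_(x | B1 y z x) m x <= eps) ->
  (forall y z, \sum_(x | B2 y z x) m x <= eps) ->
  (forall y z, \sum_(x | B3 y z x) m x <= eps) ->
  exists x y z, [/\ m x != 0, m y != 0 & m z != 0] /\
    [/\ ~~ B1 y z x, ~~ B2 x z y & ~~ B3 x y z].
Proof.
move=> m0 Mlt e0 h1 h2 h3; set M := \sum_x m x in Mlt.
pose good x y z := [&& m x != 0, m y != 0 & m z != 0] &&
  [&& ~~ B1 y z x, ~~ B2 x z y & ~~ B3 x y z].
case: (boolP [exists x, exists y, exists z, good x y z]) => [|nogood].
  by case/existsP=> x /existsP[y /existsP[z /andP[/and3P mP /and3P BP]]]; exists x, y, z.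
have bound (B : T -> T -> pred T) :
    (forall y z, \sum_(x | B y z x) m x <= eps) ->
    \sum_y \sum_z \sum_x m y * m z * (m x *+ B y z x) <= eps * M ^+ 2.
  move=> hB; have -> : eps * M ^+ 2 = \sum_y \sum_z m y * m z * eps.
    under eq_bigr do rewrite -mulr_suml -mulr_sumr.
    by rewrite -!mulr_suml expr2 mulrC.
  apply: ler_sum => y _; apply: ler_sum => z _.
  rewrite -mulr_sumr ler_wpM2l ?mulr_ge0 //; apply: le_trans (hB y z).
  by rewrite [leRHS]big_mkcond ler_sum // => x _; case: (B y z x).
(* Without a good triple, every triple of nonzero weight is counted by at least one of the three
   events. *)
have cube : M ^+ 3 <= \sum_x \sum_y \sum_z m x * m y * m z *+
    (B1 y z x + B2 x z y + B3 x y z).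
  have -> : M ^+ 3 = \sum_x \sum_y \sum_z m x * m y * m z.
    under eq_bigr do under eq_bigr do rewrite -mulr_sumr -/M.
    under eq_bigr do rewrite -mulr_suml -mulr_sumr -/M.
    by rewrite -!mulr_suml !exprS mulr1 mulrA.
  apply: ler_sum => x _; apply: ler_sum => y _; apply: ler_sum => z _.
  have p0 : 0 <= m x * m y * m z by rewrite !mulr_ge0.
  move: nogood; rewrite !negb_exists => /forallP/(_ x).
  rewrite negb_exists => /forallP/(_ y).
  rewrite negb_exists => /forallP/(_ z); rewrite /good.
  case: eqP => [->|_]; first by rewrite !mul0r mul0rn.
  case: eqP => [->|_]; first by rewrite mulr0 !mul0r mul0rn.
  case: eqP => [->|_]; first by rewrite mulr0 mul0rn.
  rewrite /= => nb; have : (0 < B1 y z x + B2 x z y + B3 x y z)%N.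
    by move: nb; case: (B1 y z x); case: (B2 x z y); case: (B3 x y z).
  by case: (_ + _ + _)%N => // k _; rewrite mulrS lerDl mulrn_wge0.
have M0 : 0 < M by lra.
suff : M ^+ 3 <= 3 * eps * M ^+ 2.
  by rewrite (exprS M 2) ler_pM2r ?exprn_gt0 // leNgt Mlt.
apply: le_trans cube _.
under eq_bigr do under eq_bigr do under eq_bigr do rewrite !mulrnDr.
under eq_bigr do under eq_bigr do rewrite !big_split /=.
under eq_bigr do rewrite !big_split /=.
rewrite !big_split /=.
have -> : 3 * eps * M ^+ 2 = eps * M ^+ 2 + eps * M ^+ 2 + eps * M ^+ 2 by lra.
apply: lerD; first apply: lerD.
(* The sums are reordered so that the vertex restricted by the event is innermost, as in [bound]. *)
- apply: le_trans (bound _ h1); rewrite exchange_big /= le_eqVlt; apply/orP; left.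
  apply/eqP/eq_bigr => y _; rewrite exchange_big; apply: eq_bigr => z _.
  by apply: eq_bigr => x _; rewrite mulrnAr [in RHS]mulrC mulrA.
- apply: le_trans (bound _ h2); rewrite le_eqVlt; apply/orP; left.
  apply/eqP/eq_bigr => x _; rewrite exchange_big; apply: eq_bigr => z _.
  by apply: eq_bigr => y _; rewrite mulrnAr mulrAC.
- apply: le_trans (bound _ h3); rewrite le_eqVlt; apply/orP; left.
  apply/eqP; do 3![apply: eq_bigr => ? _]; by rewrite mulrnAr.
Qed.

(** * Induced paths in P_6-free graphs *)

Section Graph.
Variables (T : finType) (e : rel T).

(* Distinctness of the vertices is not required: it is automatic from six
   vertices on, because the vertices of P_6 have distinct neighbourhoods. *)
Fixpoint induced_path (s : seq T) : bool :=
  if s is x :: s' then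
    (if s' is y :: s'' then e x y && all (fun z => ~~ e x z) s'' else true)
    && induced_path s'
  else true.

(** Attaching [x] at its last neighbour on the path leaves no chord. *)
Lemma induced_path_cons_suffix x y s :
  induced_path (rcons s y) -> has (e x) (rcons s y) ->
  exists2 q, {subset q <= s} & induced_path (x :: rcons q y).
Proof.
elim: s => [|z s IH] /=; first by rewrite orbF => _ exy; exists [::]; rewrite //= exy.
case/andP=> zs sP; have [hs _|nhs] := boolP (has (e x) (rcons s y)).
  by have [q qs qP] := IH sP hs; exists q => // u /qs us; rewrite inE us orbT.
rewrite orbF => exz; exists (z :: s) => //=.
by rewrite exz zs sP !andbT -all_predC in nhs *.
Qed.

Lemma induced_path_of_path x p y : path e x (rcons p y) ->
  exists2 q, {subset q <= p} & induced_path (x :: rcons q y).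
Proof.
elim: p x => [|z p IH] x /=; first by rewrite andbT => exy; exists [::]; rewrite //= exy.
case/andP=> exz /IH[q qp qP].
have [|q' qq' q'P] := @induced_path_cons_suffix x y (z :: q) qP.
  by rewrite /= exz.
exists q' => // u /qq'; rewrite !inE => /orP[->//|/qp->]; exact: orbT.
Qed.

Hypotheses (esym : symmetric e) (eirr : irreflexive e) (P6f : P6_free e).

Lemma P6_free_induced_path s : induced_path s -> (size s <= 5)%N.
Proof.
case: s => [|v0 [|v1 [|v2 [|v3 [|v4 [|v5 s]]]]]] //= sP; exfalso.
pose f (i : 'I_6) := nth v0 [:: v0; v1; v2; v3; v4; v5] i.
have adj i j : e (f i) (f j) = ((i.+1 == j :> nat) || (j.+1 == i :> nat)).
  move: sP; rewrite /f -!andbA.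
  do ![case/andP; (move/negbTE=> ? || move=> ?)] => _.
  by case: i => [[|[|[|[|[|[|?]]]]]] //= ?]; case: j => [[|[|[|[|[|[|?]]]]]] //= ?];
   rewrite ?eirr // esym.
apply: (P6f (f := f)); split=> // i j fij; apply/val_inj.
have rows k : e (f i) (f k) = e (f j) (f k) by rewrite fij.
move: (rows (inord 0)) (rows (inord 1)) (rows (inord 2)) (rows (inord 3))
  (rows (inord 4)) (rows (inord 5)); rewrite !adj !inordK // {rows fij}.
by case: i => [[|[|[|[|[|[|?]]]]]] //= ?]; case: j => [[|[|[|[|[|[|?]]]]]] //= ?].
Qed.

Lemma P6_free_size_interior x q y :
  induced_path (x :: rcons q y) -> (size q <= 3)%N.
Proof. by move/P6_free_induced_path; rewrite /= size_rcons. Qed.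

Ltac split_hyps := repeat match goal with
  | H : is_true (_ && _) |- _ => case/andP: H => ? ?
  | H : is_true (~~ (_ || _)) |- _ => case/norP: H => ? ?
  end.
Ltac P6 s := (suff: induced_path s by move/P6_free_induced_path);
  rewrite /=; repeat match goal with |- is_true (_ && _) => apply/andP; split end;
  first [done | assumption | rewrite esym; assumption].

(** The list that each [xi] must avoid depends only on the other two vertices once the [bi] and the
    paths are chosen as functions; this is the shape that [exists_triple_avoiding] handles. *)
Lemma P6_free_no_triple x1 x2 x3 b1 b2 b3 p q :
  induced_path (x1 :: rcons p x2) -> induced_path (x2 :: rcons q x3) ->
  [/\ e x1 b1, e x2 b2 & e x3 b3] ->
  ~~ has (e x1) (x2 :: x3 :: b2 :: b3 :: q) ->
  ~~ has (e x2) [:: x1; x3; b1; b3] ->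
  ~~ has (e x3) (x1 :: x2 :: b1 :: b2 :: p) ->
  ~~ has (fun b => has (e b) (p ++ q)) [:: b1; b2; b3] -> False.
Proof.
move=> pP qP [xb1 xb2 xb3] h1 h2 h3 hb.
have sp := P6_free_size_interior pP; have sq := P6_free_size_interior qP.
(* An empty [p] or [q] would give the forbidden edge [x1 x2] or [x2 x3]; nine pairs of lengths from
   1 to 3 remain. *)
move: p q sp sq pP qP h1 h2 h3 hb.
case=> [|c [|c' [|c'' [|? ?]]]]; case=> [|d [|d' [|d'' [|? ?]]]] //= _ _ *; split_hyps;
  try match goal with H : is_true (e ?x ?y), H' : is_true (~~ e ?x ?y) |- _ =>
    by case/negP: H' end.
all: have [b12|b12] := boolP (e b1 b2).
all: try first [P6 [:: x1; b1; b2; x2; d; d'] | P6 [:: x1; b1; b2; x2; d; x3]].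
all: have [b23|b23] := boolP (e b2 b3).
(* Here [p] is followed backwards from [x2], and [x3] has no neighbour on it. *)
all: try first [P6 [:: x3; b3; b2; x2; c''; c'] | P6 [:: x3; b3; b2; x2; c'; c]
  | P6 [:: x3; b3; b2; x2; c; x1]].
all: try first [P6 [:: b1; x1; c; c'; x2; b2] | P6 [:: b1; x1; c; c'; c''; x2]].
all: try first [P6 [:: b2; x2; d; d'; x3; b3] | P6 [:: b2; x2; d; d'; d''; x3]].
have [b13|b13] := boolP (e b1 b3); first by P6 [:: x1; b1; b3; x3; d; x2].
have [cd|cd] := boolP (e c d); first by P6 [:: b1; x1; c; d; x3; b3].
by P6 [:: b1; x1; c; x2; d; x3].
Qed.
End Graph.

(** * Union bound for neighbourhoods *)

Lemma sum_has_le (K : realFieldType) (T : finType) (e : rel T) (m : T -> K)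
    (g : K) (L : seq T) :
  (forall x, 0 <= m x) -> (forall u, \sum_(x | e x u) m x <= g) ->
  \sum_(x | has (e x) L) m x <= (size L)%:R * g.
Proof.
move=> m0 hg; elim: L => [|u L IH] /=; first by rewrite big_pred0_eq mul0r.
rewrite -natr1 mulrDl mul1r addrC; apply: le_trans (lerD (hg u) IH).
rewrite big_mkcond [\sum_(x | e x u) _]big_mkcond.
rewrite [\sum_(x | has _ _) _]big_mkcond -big_split /=; apply: ler_sum => x _.
by case: (e x u); case: has; rewrite ?addr0 ?add0r ?lerDl ?m0.
Qed.

(** * Components of G - X and the effect of removing a vertex from X *)

Section Components.
Variables (T : finType) (e : rel T) (X : {set T}).
Hypothesis esym : symmetric e.

Lemma del_rel_sym (Y : {set T}) : symmetric (del_rel e Y).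
Proof. by move=> x y; rewrite /del_rel esym; congr (_ && _); apply: andbC. Qed.

Lemma comp_del_eq (Y : {set T}) u v :
  u \in comp_del e Y v -> comp_del e Y u = comp_del e Y v.
Proof.
rewrite inE => uv; apply/setP=> w; rewrite !inE.
by rewrite (same_connect (sym_connect_sym (del_rel_sym Y)) uv).
Qed.

Lemma comp_del_notin (Y : {set T}) u v :
  v \notin Y -> u \in comp_del e Y v -> u \notin Y.
Proof.
move=> vY; rewrite inE => /connectP[p + ->]; elim: p v vY => //= z p IH v vY.
by case/andP=> /and3P[_ _ zY]; apply: IH.
Qed.

Lemma comp_del_step u v w : v \notin X -> u \in comp_del e X v ->
  w \notin X -> e u w -> w \in comp_del e X v.
Proof.
move=> vX uv wX euw; have uX := comp_del_notin vX uv.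
rewrite inE in uv; rewrite inE; apply: connect_trans uv (connect1 _).
by rewrite /del_rel euw uX.
Qed.

(** This is the union of the components of G - X in which [x] has a neighbour. *)
Definition touched (x : T) : {set T} :=
  [set u | (u \notin X) && [exists a in comp_del e X u, e x a]].

Lemma induced_path_through_comp x y v :
  v \in touched x -> v \in touched y ->
  exists2 q, {subset q <= comp_del e X v} & induced_path e (x :: rcons q y).
Proof.
rewrite [v \in touched x]inE [v \in touched y]inE.
move=> /andP[vX /exists_inP[a av xa]] /andP[_ /exists_inP[c cv yc]].
have /connectP[p pP cE] : connect (del_rel e X) a c.
  by move: cv; rewrite -(comp_del_eq av) inE.
have [|q qp qP] := @induced_path_of_path _ e x (a :: p) y.
  rewrite /= rcons_path xa -cE esym yc andbT /=.
  by apply: sub_path pP => u w /and3P[].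
exists q => // u /qp; rewrite inE => /orP[/eqP-> //|up].
rewrite -(comp_del_eq av) inE; exact: (path_connect pP (mem_behead (s := a :: p) up)).
Qed.

Lemma path_del_setD1 x z p : x \notin z :: p ->
  path (del_rel e (X :\ x)) z p -> path (del_rel e X) z p.
Proof.
move=> xzp; apply: (@sub_in_path _ [pred w | w != x]).
  by move=> u w ux wx; rewrite /del_rel !inE (negbTE ux) (negbTE wx).
by apply/allP=> w wzp /=; apply: contraNneq xzp => <-.
Qed.

Lemma comp_del_setD1_subset x z : x \notin comp_del e (X :\ x) z ->
  comp_del e (X :\ x) z \subset comp_del e X z.
Proof.
move=> xz; apply/subsetP=> u; rewrite !inE => /connectP[p pP ->].
apply/connectP; exists p => //; apply: path_del_setD1 (pP).
by apply: contra xz => xp; rewrite inE (path_connect pP).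
Qed.

(** A repetition-free walk from [x] never returns to [x], so after its first edge it stays in a
    single component of G - X. *)
Lemma comp_del_setD1_touched x z : z \notin X :\ x -> x \in comp_del e (X :\ x) z ->
  comp_del e (X :\ x) z \subset x |: touched x.
Proof.
move=> zY xz; apply/subsetP=> u uz; rewrite in_setU1; have [//|ux] := eqVneq u x.
have uX : u \notin X by have := comp_del_notin zY uz; rewrite !inE ux.
move: uz; rewrite -(comp_del_eq xz) !inE uX /= => /connectP[p pP uE].
case/shortenP: pP uE => [[|a p'] /= + + _] => [_ _ uE|/andP[xa pP] /andP[xp _] uE].
  by rewrite uE eqxx in ux.
apply/exists_inP; exists a; last by case/and3P: xa.
rewrite inE (sym_connect_sym (del_rel_sym X)); apply/connectP.
by exists p' => //; apply: path_del_setD1 pP.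
Qed.
End Components.

(** * Consequences of minimality *)

(** Otherwise [X :\ x] would be a nuke: the component of [x] gains the vertex [x] itself, but the
    deleted set loses it, and components avoiding [x] do not grow. *)
Lemma minimal_nuke_touched (T : finType) (e : rel T) (eta tau : R) (X : {set T}) x :
  symmetric e -> minimal_nuke e eta tau X -> x \in X ->
  tau < (#|touched e X x| + #|X|)%:R.
Proof.
move=> esym [[tauP cardX compX] minX] xX; rewrite ltNge; apply/negP=> small.
have cardY : #|X| = #|X :\ x|.+1 by rewrite (cardsD1 x) xX.
apply: (minX _ (properD1 xX)); split=> // [|z zY].
  by apply: le_trans cardX; rewrite ler_nat cardY.
have [xz|xz] := boolP (x \in comp_del e (X :\ x) z).
  apply: le_trans small; rewrite ler_nat cardY addnS -addSn leq_add2r.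
  apply: leq_trans (subset_leq_card (comp_del_setD1_touched esym zY xz)) _.
  by rewrite cardsU1; case: (_ \notin _).
have zX : z \notin X.
  apply: contra xz => zX; move: zY; rewrite !inE zX andbT negbK => /eqP->.
  exact: connect0.
apply: le_trans (compX _ zX); rewrite ler_nat cardY.
by rewrite leq_add ?subset_leq_card ?comp_del_setD1_subset.
Qed.

Lemma heavy_component (T : finType) (e : rel T) (eta tau : R) (X : {set T})
    (mu : T -> R) :
  symmetric e -> (0 < #|T|)%N -> eta <= 1 / 10 ->
  minimal_nuke e eta tau X -> prob_on X mu ->
  exists2 v, v \notin X & 1 / 2 <= \sum_(x in X | v \in touched e X x) mu x.
Proof.
move=> esym T0 eta10 nX [mu0 _ mu1].
case: (boolP [exists v, (v \notin X) &&
    (1 / 2 <= \sum_(x in X | v \in touched e X x) mu x)]) => [|light].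
  by case/existsP=> v /andP[]; exists v.
have [[/andP[tauP _] cardX _] _] := nX.
(* Double counting: [S] is the expected size of [touched e X x] for [x] drawn from [mu]. *)
pose S := \sum_(v | v \notin X) \sum_(x in X | v \in touched e X x) mu x.
have Sle : S <= 1 / 2 * #|T|%:R.
  rewrite mulr_natr -sumr_const /S big_mkcond /=; apply: ler_sum => v _.
  case: ifP => [vX|_]; last by lra.
  move: light; rewrite negb_exists => /forallP/(_ v); rewrite vX /= -ltNge.
  exact: ltW.
have Sge : tau - #|X|%:R <= S.
  rewrite /S (exchange_big_dep (mem X)) /=; last by move=> v x _ /andP[].
  rewrite -[leLHS]mul1r -[X in X * _ <= _]mu1 mulr_suml; apply: ler_sum => x xX.
  rewrite (eq_bigl (fun v => v \in touched e X x)); last first.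
    by move=> v; rewrite xX /= inE; case: (v \notin X).
  rewrite sumr_const -[leRHS]mulr_natr ler_wpM2l //.
  by have := minimal_nuke_touched esym nX xX; rewrite natrD; lra.
(* The contradiction is that [tau - |X|] is at least [(1 - 3 * eta) * |T|], hence at least 7/10 of
   [|T|], while [S] is at most half of it. *)
have n0 : 0 < #|T|%:R :> R by rewrite ltr0n.
have := ler_wpM2r (ltW n0) eta10; lra.
Qed.

(** The touched set has more than [tau - |X|] vertices, too many for one component. *)
Lemma exists_nbr_off_comp (T : finType) (e : rel T) (eta tau : R) (X : {set T}) x v :
  symmetric e -> minimal_nuke e eta tau X -> x \in X -> v \notin X ->
  exists b, [/\ b \notin X, b \notin comp_del e X v & e x b].
Proof.
move=> esym nX xX vX; have [[_ _ compX] _] := nX.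
have /subsetPn[u] : ~~ (touched e X x \subset comp_del e X v).
  apply: contraTN (minimal_nuke_touched esym nX xX) => tv; rewrite -leNgt.
  by apply: le_trans (compX _ vX); rewrite ler_nat leq_add2r subset_leq_card.
rewrite inE => /andP[uX /exists_inP[b bu xb]] uv; exists b; split=> //.
  exact: comp_del_notin uX bu.
apply: contra uv => bv; rewrite -(comp_del_eq esym bv) (comp_del_eq esym bu).
by rewrite inE connect0.
Qed.

(** * Choice of the triple and conclusion *)

Theorem theorem8 :
  exists gamma : R, 0 < gamma /\
  forall eta : R, 0 < eta -> eta <= 1 / 10 ->
  forall (T : finType) (e : rel T),
    simple_graph e -> connected_graph e -> P6_free e -> (2 <= #|T|)%N ->
  forall tau : R, 0 <= tau ->
    (1 - 2 * eta) * (#|T|%:R) <= tau -> tau <= (1 - eta) * (#|T|%:R) ->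
  forall X : {set T}, minimal_nuke e eta tau X ->
  forall mu : T -> R, prob_on X mu ->
  exists v : T, gamma <= mu_nbhd e X mu v.
Proof.
(* Each avoided list has at most 2 + 2 + 3 = 7 vertices, so 1/200 suffices: 3 * 7/200 < 1/2. *)
exists (1 / 200); split; first lra.
move=> eta _ eta10 T e [esym eirr] _ P6f T2 tau _ _ _ X nX mu muP.
have [v vX heavy] := heavy_component esym (ltnW T2) eta10 nX muP.
have [mu0 _ _] := muP.
case: (boolP [exists v, 1 / 200 <= mu_nbhd e X mu v]) => [/existsP//|].
rewrite negb_exists => /forallP light; exfalso.
pose tX x := (x \in X) && (v \in touched e X x).
pose m x := if tX x then mu x else 0.
have m0 x : 0 <= m x by rewrite /m; case: ifP.
have mlight u : \sum_(x | e x u) m x <= 1 / 200.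
  have := light u; rewrite -ltNge => /ltW; apply: le_trans.
  rewrite /mu_nbhd big_mkcond [leRHS]big_mkcond; apply: ler_sum => x _.
  by rewrite /m /tX esym; case: (x \in X); case: (e u x); case: (v \in touched e X x);
    rewrite /= ?mu0 ?lexx.
have {heavy} mheavy : 1 / 2 <= \sum_x m x by rewrite -big_mkcond.
have nbrP x : exists b, tX x ->
    [/\ b \notin X, b \notin comp_del e X v & e x b].
  case: (boolP (tX x)) => [/andP[xX _]|_]; last by exists v.
  by have [b bP] := exists_nbr_off_comp esym nX xX vX; exists b.
have [b bP] := fin_all_exists nbrP.
(* The length bound stands outside the implication, with the empty path as default, so that the
   lists stay short for all pairs. *)
have pathP (xy : T * T) : exists q, (size q <= 3)%N /\ (tX xy.1 -> tX xy.2 ->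
    {subset q <= comp_del e X v} /\ induced_path e (xy.1 :: rcons q xy.2)).
  case: xy => x y /=; have [/andP[_ xv]|_] := boolP (tX x); last by exists [::].
  have [/andP[_ yv]|_] := boolP (tX y); last by exists [::].
  have [q qv qP] := induced_path_through_comp esym xv yv.
  by exists q; split=> //; apply: P6_free_size_interior qP.
have {pathP}[q qP] := fin_all_exists pathP.
have few (L : seq T) : (size L <= 7)%N -> \sum_(x | has (e x) L) m x <= 7 / 200.
  move=> sL; apply: le_trans (sum_has_le L m0 mlight) _.
  have : (size L)%:R <= 7 :> R by rewrite ler_nat.
  by lra.
have tXm x : m x != 0 -> tX x by rewrite /m; case: ifP; rewrite ?eqxx.
have [|||||x1 [x2 [x3 [[x1m x2m x3m] [far1 far2 far3]]]]] := exists_triple_avoiding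
  (B1 := fun y z x => has (e x) (y :: z :: b y :: b z :: q (y, z)))
  (B2 := fun y z x => has (e x) [:: y; z; b y; b z])
  (B3 := fun y z x => has (e x) (y :: z :: b y :: b z :: q (y, z)))
  (eps := 7 / 200) m0; try by [lra | move=> *; apply: few].
- by move=> y z; apply: few; rewrite /= !ltnS; have [] := qP (y, z).
- by move=> y z; apply: few; rewrite /= !ltnS; have [] := qP (y, z).
have [[t1 t2] t3] := (tXm _ x1m, tXm _ x2m, tXm _ x3m).
have [b1X b1v xb1] := bP _ t1; have [b2X b2v xb2] := bP _ t2.
have [b3X b3v xb3] := bP _ t3.
have [_ /(_ t1 t2)[pv pP]] := qP (x1, x2); have [_ /(_ t2 t3)[rv rP]] := qP (x2, x3).
apply: (P6_free_no_triple esym eirr P6f pP rP) far1 far2 far3 _ => //.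
(* A vertex outside [X] with a neighbour in the component of [v] would belong to that component. *)
have off c : c \notin X -> c \notin comp_del e X v ->
    ~~ has (e c) (q (x1, x2) ++ q (x2, x3)).
  move=> cX cv; apply/hasPn=> u; rewrite mem_cat => uq.
  have uv : u \in comp_del e X v by case/orP: uq => [/pv|/rv].
  by apply: contra cv => cu; apply: comp_del_step uv cX _; rewrite // esym.
by rewrite /= !negb_or !off.
Qed.
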